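(* Let $(X,r)$ be a finite left non-degenerate idempotent set-theoretic solution of the Yang--Baxter equation and let $u\in\Lambda$. Then: \begin{enumerate} \item $c_u:=(du,\mathrm{id})\in S_u$ is a central element in $S_u$. \item $S_u=\langle c_u\rangle\circ F_u$, where $F_u:=\{(a,\lambda_a)\in S_u:0<|a|\le d\}$ is a finite set and $\langle c_u\rangle$ is the monoid generated by $c_u$. \item $S_u$ has a group of quotients, denoted by $G_u$, that is a finite conjugacy group (FC-group). In particular, its elements of finite order form a finite group, denoted by $T(G_u)$. \item $G_u/T(G_u)\cong\mathbb{Z}$ and there exists an element $x_u\in X$ so that $(x_u,\lambda_{x_u})\in S_u$ and $G_u/T(G_u)$ is generated by the coset $(x_u,\lambda_{x_u})\circ T(G_u)$. \end{enumerate} In particular, $G_u\cong T(G_u)\rtimes_{\sigma_u}\mathrm{gr}(x_u)\cong T(G_u)\rtimes\mathbb{Z}$, a semidirect product, where the action $\sigma_u$ is given by conjugation by $x_u=(x_u,\lambda_{x_u})$ and $\mathrm{gr}(x_u)$ is the subgroup of $G_u$ generated by it. Furthermore, $S=S(X,r)$ is cancellative if and only if $|\Lambda|=1$.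
   Context: A set-theoretic solution of the Yang--Baxter equation is a pair $(X,r)$ with $X$ a non-empty set and $r\colon X\times X\to X\times X$ a map satisfying $(r\times\mathrm{id})(\mathrm{id}\times r)(r\times\mathrm{id})=(\mathrm{id}\times r)(r\times\mathrm{id})(\mathrm{id}\times r)$. Write $r(x,y)=(\lambda_x(y),\rho_y(x))$. It is finite if $X$ is finite, left non-degenerate if every $\lambda_x\colon X\to X$ is bijective, and idempotent if $r^2=r$. The diagonal map is $q\colon X\to X$, $q(x)=\lambda_x^{-1}(x)$, and $\Lambda=q(X)$. The structure monoid is $M=M(X,r)=\langle X\mid x\circ y=\lambda_x(y)\circ\rho_y(x),\ x,y\in X\rangle$ and the structure semigroup is $S=S(X,r)=M\setminus\{1\}$. For $(X,r)$ left non-degenerate and idempotent, the derived structure monoid is $A=A(X,r)=\langle X\mid x+y=y+y,\ x,y\in X\rangle$ (written additively); every non-zero element is uniquely of the form $nx$ with $n\ge1$, $x\in X$, one has $nx+my=(n+m)y$ for $m\ge1$, and its length is $|nx|=n$. Each $\lambda_x$ extends to an automorphism of $A$, and this yields a monoid homomorphism $\lambda\colon(M,\circ)\to\mathrm{Aut}(A,+)$, $m\mapsto\lambda_m$. There is a bijection $\pi\colon M\to A$ with $\pi(x)=x$ for $x\in X$ and $\pi(m\circ m')=\pi(m)+\lambda_m(\pi(m'))$. For $a\in A$ write $\lambda_a=\lambda_{\pi^{-1}(a)}$. Identify $m\in M$ with $(\pi(m),\lambda_m)\in A\rtimes\mathrm{Aut}(A,+)$; thus $M=\{(a,\lambda_a):a\in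 A\}$, the generator $x\in X$ is $(x,\lambda_x)$, and $(a,\lambda_a)\circ(b,\lambda_b)=(a+\lambda_a(b),\lambda_a\lambda_b)$ with $\lambda_{a+\lambda_a(b)}=\lambda_a\lambda_b$. For $u\in\Lambda$, $S_u=\{(a,\lambda_a)\in S:\lambda_a^{-1}(a)=|a|u\}$; these are cancellative subsemigroups of $S$ and $S$ is their disjoint union. The symbol $d$ denotes a fixed positive multiple of the exponent of the permutation group $\mathcal{G}(X,r)=\mathrm{gr}(\lambda_x:x\in X)\subseteq\mathrm{Sym}(X)$; in particular $\lambda_a^d=\mathrm{id}$ for all $a\in A$. A group is an FC-group if all its conjugacy classes are finite. *)

(* Defs.v *)
From HB Require Import structures.
From mathcomp Require Import fingroup perm abelian.
From mathcomp Require Import all_boot all_order ssralg ssrint.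
From mathcomp Require Import boolp classical_sets cardinality.

Set Implicit Arguments.
Unset Strict Implicit.
Unset Printing Implicit Defensive.

Local Open Scope quotient_scope.
Local Open Scope classical_set_scope.
Local Open Scope group_scope.

(* [quad_monoid f] is the monoid < X | x y = (f (x, y)).1 (f (x, y)).2 >, the
   quotient of the free monoid [seq X] by the congruence generated by the
   relations. *)
Section QuadMonoid.
Variables (X : choiceType) (f : X * X -> X * X).
Implicit Types s t u v : seq X.

Inductive quad_cong : seq X -> seq X -> Prop :=
| quad_refl s : quad_cong s s
| quad_sym s t : quad_cong s t -> quad_cong t s
| quad_trans s t u : quad_cong s t -> quad_cong t u -> quad_cong s u
| quad_step u v x y :
    quad_cong (u ++ [:: x; y] ++ v) (u ++ [:: (f (x, y)).1; (f (x, y)).2] ++ v).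

Definition quad_rel : rel (seq X) := [rel s t | `[< quad_cong s t >]].

Lemma quad_rel_equiv : equiv_class_of quad_rel.
Proof.
split=> [s|s t|t s u].
- exact/asboolP/quad_refl.
- by apply/asboolP/asboolP; apply: quad_sym.
- by move=> /asboolP st /asboolP tu; apply/asboolP/(quad_trans st tu).
Qed.

Canonical quad_equiv := EquivRelPack quad_rel_equiv.

Definition quad_monoid : Type := {eq_quot quad_rel}.
HB.instance Definition _ := EqQuotient.on quad_monoid.
HB.instance Definition _ := Choice.on quad_monoid.

Definition quad_class s : quad_monoid := \pi_quad_monoid s.
Definition quad_repr (a : quad_monoid) : seq X := repr a.

Lemma quad_reprK : cancel quad_repr quad_class.
Proof. exact: reprK. Qed.

Lemma quad_classP s t : quad_cong s t <-> quad_class s = quad_class t.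
Proof.
have P := @eqquotP _ quad_rel quad_monoid s t.
by split=> [/asboolP H|/P/asboolP //]; apply/P.
Qed.

Lemma quad_classW (P : quad_monoid -> Prop) :
  (forall s, P (quad_class s)) -> forall a, P a.
Proof. by move=> Ps a; rewrite -[a]quad_reprK. Qed.

Lemma quad_reprP s : quad_cong (quad_repr (quad_class s)) s.
Proof. by apply/quad_classP; rewrite quad_reprK. Qed.

Lemma quad_cong_cat s s' t t' :
  quad_cong s s' -> quad_cong t t' -> quad_cong (s ++ t) (s' ++ t').
Proof.
move=> ss' tt'; apply: (@quad_trans _ (s' ++ t)).
  elim: ss' => {s s'} [s|s u _|s u v _ IH1 _|u v x y]; first exact: quad_refl.
  - exact: quad_sym.
  - exact: quad_trans.
  - by rewrite -!catA; apply: quad_step.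
elim: tt' => {t t'} [t|t u _|t u v _ IH1 _|u v x y]; first exact: quad_refl.
- exact: quad_sym.
- exact: quad_trans.
- by rewrite !(catA s' u); apply: quad_step.
Qed.

Definition quad_one : quad_monoid := quad_class [::].
Definition quad_mul (a b : quad_monoid) : quad_monoid :=
  quad_class (quad_repr a ++ quad_repr b).

Lemma quad_mulE s t :
  quad_mul (quad_class s) (quad_class t) = quad_class (s ++ t).
Proof. by apply/quad_classP; apply: quad_cong_cat; apply: quad_reprP. Qed.

Lemma quad_mulA : associative quad_mul.
Proof.
elim/quad_classW=> s; elim/quad_classW=> t; elim/quad_classW=> u.
by rewrite !quad_mulE catA.
Qed.

Lemma quad_mul1 : left_id quad_one quad_mul.
Proof. by elim/quad_classW=> s; rewrite quad_mulE. Qed.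

Lemma quad_mulr1 : right_id quad_one quad_mul.
Proof. by elim/quad_classW=> s; rewrite quad_mulE cats0. Qed.

HB.instance Definition _ :=
  isMonoid.Build quad_monoid quad_mulA quad_mul1 quad_mulr1.

Definition gen (x : X) : quad_monoid := quad_class [:: x].

(* The defining relations preserve the length of words, so any representative
   may be used. *)
Definition len (a : quad_monoid) : nat := size (quad_repr a).

Lemma quad_class_cat s t : quad_class (s ++ t) = quad_class s * quad_class t.
Proof. by rewrite [RHS]quad_mulE. Qed.

Lemma quad_cons x s : quad_class (x :: s) = gen x * quad_class s.
Proof. exact: (quad_class_cat [:: x]). Qed.

Lemma quad_genM x y : gen x * gen y = gen (f (x, y)).1 * gen (f (x, y)).2.
Proof.
rewrite /gen -!quad_class_cat; apply/quad_classP.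
exact: (quad_step [::] [::]).
Qed.

Lemma quad_ind (P : quad_monoid -> Prop) :
  P 1 -> (forall x a, P a -> P (gen x * a)) -> forall a, P a.
Proof.
move=> P1 PM; elim/quad_classW; elim=> [//|x s IH].
by rewrite quad_cons; apply: PM.
Qed.

Lemma quad_cong_size s t : quad_cong s t -> size s = size t.
Proof.
elim=> {s t} [s|s t _ ->|s t u _ -> _ ->|u v x y] //.
by rewrite !size_cat.
Qed.

Lemma lenE s : len (quad_class s) = size s.
Proof. exact: quad_cong_size (quad_reprP s). Qed.

Lemma len1 : len (1 : quad_monoid) = 0%N.
Proof. exact: lenE. Qed.

Lemma len_gen x : len (gen x) = 1%N.
Proof. exact: lenE. Qed.

Lemma lenM (a b : quad_monoid) : len (a * b) = (len a + len b)%N.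
Proof.
elim/quad_classW: a => s; elim/quad_classW: b => t.
by rewrite -quad_class_cat !lenE size_cat.
Qed.

End QuadMonoid.

Section Solution.
Variables (X : Type) (r : X * X -> X * X).

Definition yang_baxter : Prop :=
  let r12 (t : X * X * X) := let: (x, y, z) := t in (r (x, y), z) in
  let r23 (t : X * X * X) :=
    let: (x, y, z) := t in (x, (r (y, z)).1, (r (y, z)).2) in
  forall t, r12 (r23 (r12 t)) = r23 (r12 (r23 t)).

Definition lam (x y : X) : X := (r (x, y)).1.
Definition rho (y x : X) : X := (r (x, y)).2.

Definition left_nondegenerate : Prop := forall x, bijective (lam x).

End Solution.

(* The derived structure monoid A(X, r) = < X | x + y = y + y > is usually
   written additively: [a * b] is a + b, [a ^+ n] is n a and
   [1] is 0. *)
Definition derived_monoid (X : choiceType) : Type :=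
  @quad_monoid X (fun p => (p.2, p.2)).
HB.instance Definition _ (X : choiceType) := Monoid.on (derived_monoid X).

Definition structure_monoid (X : choiceType) (r : X * X -> X * X) : Type :=
  quad_monoid r.
HB.instance Definition _ (X : choiceType) (r : X * X -> X * X) :=
  Monoid.on (structure_monoid r).

Section Structure.
Variables (X : finType) (r : X * X -> X * X).

Local Notation M := (structure_monoid r).
Local Notation A := (derived_monoid X).

Definition genM (x : X) : M := gen r x.
Definition genA (x : X) : A := gen (fun p => (p.2, p.2)) x.
Definition lenA (a : A) : nat := len a.

(* [finv g] is the inverse of the injective map [g]. *)
Definition diag (x : X) : X := finv (lam r x) x.

Definition Lambda : {set X} := [set diag x | x : X]%SET.

Definition perm_group : {group {perm X}} :=
  <<[set s : {perm X} | [exists x, [forall y, s y == lam r x y]]]%SET>>%G.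

(* The endomorphism of A induced by a map on generators. *)
Definition amap (g : X -> X) (a : A) : A :=
  quad_class _ (map g (quad_repr a)).

Definition lam_word (w : seq X) : X -> X := foldr (fun x g => lam r x \o g) id w.

(* [lamM m] is the action of lambda_m on the generators of A. *)
Definition lamM (m : M) : X -> X := lam_word (quad_repr m).
Definition lambda (m : M) : A -> A := amap (lamM m).
Definition lambdaV (m : M) : A -> A := amap (finv (lamM m)).

Definition pi_word (w : seq X) : A :=
  foldr (fun x a => genA x * amap (lam r x) a) 1 w.
Definition piA (m : M) : A := pi_word (quad_repr m).

(* [elt a] is the element (a, lambda_a) of M, that is the inverse image of [a]
   under the bijection [piA]; see [eltK] and [piAK]. *)
Definition elt (a : A) : M := xget 1 [set m | piA m = a].

Definition structure_semigroup : set M := [set m | m <> 1].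

Definition S_ (u : X) : set M :=
  [set m | structure_semigroup m /\ lambdaV m (piA m) = genA u ^+ lenA (piA m)].

Definition c_ (d : nat) (u : X) : M := elt (genA u ^+ d).

Definition F_ (d : nat) (u : X) : set M :=
  [set m | S_ u m /\ (0 < lenA (piA m) <= d)%N].

End Structure.

Arguments structure_semigroup {X} r _.
Arguments S_ {X} r u _.
Arguments F_ {X} r d u _.

Definition cancellative (M : monoidType) (S : set M) : Prop :=
  forall a b c, S a -> S b -> S c ->
    (a * b = a * c -> b = c) /\ (b * a = c * a -> b = c).

Section AMap.
Variable X : finType.
Local Notation A := (derived_monoid X).
Implicit Types (g h : X -> X) (a b : A).

Lemma genA_ind (P : A -> Prop) :
  P 1 -> (forall x a, P a -> P (genA x * a)) -> forall a, P a.
Proof. exact: quad_ind. Qed.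

Lemma genA_mul (x y : X) : genA x * genA y = genA y * genA y.
Proof. exact: quad_genM. Qed.

Lemma map_cong g (s t : seq X) : let f (p : X * X) := (p.2, p.2) in
  quad_cong f s t -> quad_cong f (map g s) (map g t).
Proof.
move=> f; elim=> {s t} [s|s t _|s t u _ IH1 _|u v x y]; first exact: quad_refl.
- exact: quad_sym.
- exact: quad_trans.
- by rewrite !map_cat; apply: (quad_step f (map g u) (map g v) (g x) (g y)).
Qed.

Lemma amap_class g (s : seq X) :
  amap g (quad_class _ s) = quad_class _ (map g s).
Proof. exact/quad_classP/map_cong/quad_reprP. Qed.

Lemma amap1 g : amap g 1 = 1.
Proof. exact: amap_class. Qed.

Lemma amap_gen g x : amap g (genA x) = genA (g x).
Proof. exact: amap_class. Qed.

Lemma amapM g : {morph amap g : a b / a * b}.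
Proof.
elim/quad_classW=> s; elim/quad_classW=> t.
by rewrite -[_ * _]quad_class_cat !amap_class map_cat [LHS]quad_class_cat.
Qed.

Lemma amap_comp g h a : amap (g \o h) a = amap g (amap h a).
Proof. by elim/quad_classW: a => s; rewrite !amap_class map_comp. Qed.

Lemma amap_id a : amap id a = a.
Proof. by elim/quad_classW: a => s; rewrite amap_class map_id. Qed.

Lemma lenA_amap g a : lenA (amap g a) = lenA a.
Proof.
by elim/quad_classW: a => s; rewrite amap_class /lenA !lenE size_map.
Qed.

Lemma lenA_genX (x : X) n : lenA (genA x ^+ n) = n.
Proof.
elim: n => [|n IH]; first exact: len1.
by rewrite expgS -[in RHS]IH [LHS]lenM [X in (X + _)%N]len_gen.
Qed.

End AMap.

Section StructureTheory.
Variables (X : finType) (r : X * X -> X * X).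
Hypotheses (ybe : yang_baxter r) (lnd : left_nondegenerate r).
Hypothesis idem : idempotent_fun r.

Local Notation M := (structure_monoid r).
Local Notation A := (derived_monoid X).
Local Notation l := (lam r).

Lemma lamlam x y z : l (l x y) (l (rho r y x) z) = l x (l y z).
Proof.
have := ybe (x, y, z); rewrite /lam /rho /=.
by case: (r (x, y)) => a b /=; case: (r (x, _)) => c e /= [/= ->].
Qed.

Lemma lam_idem x y : l (l x y) (rho r y x) = l x y.
Proof. by have /= := idem (x, y); rewrite /lam /rho -surjective_pairing => ->. Qed.

Lemma lam_word_cat s t : lam_word r (s ++ t) =1 lam_word r s \o lam_word r t.
Proof. by move=> z; elim: s => //= x s ->. Qed.

Lemma lam_word_cong s t : quad_cong r s t -> lam_word r s =1 lam_word r t.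
Proof.
elim=> {s t} [s|s t _ IH|s t u _ IH1 _ IH2|u v x y] z //.
- by rewrite IH1.
- by rewrite !lam_word_cat /= -lamlam.
Qed.

Lemma lamM_class s : lamM (quad_class r s : M) = lam_word r s.
Proof. exact/funext/lam_word_cong/quad_reprP. Qed.

Lemma lamM1 : lamM (1 : M) = id.
Proof. exact: lamM_class. Qed.

Lemma lamM_gen x : lamM (genM r x) = l x.
Proof. exact: lamM_class. Qed.

Lemma lamMM (m n : M) : lamM (m * n) = lamM m \o lamM n.
Proof.
elim/quad_classW: m => s; elim/quad_classW: n => t.
rewrite -[_ * _]quad_class_cat !lamM_class; exact/funext/lam_word_cat.
Qed.

Lemma lambdaM (m n : M) a : lambda (m * n) a = lambda m (lambda n a).
Proof. by rewrite /lambda lamMM amap_comp. Qed.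

Lemma lam_inj x : injective (l x).
Proof. exact: bij_inj (lnd x). Qed.

Lemma lamM_inj (m : M) : injective (lamM m).
Proof.
rewrite /lamM; elim: (quad_repr m) => [|x s IH] /=; first exact: inj_id.
exact: (inj_comp (@lam_inj x) IH).
Qed.

Lemma lambdaK (m : M) : cancel (lambda m) (lambdaV m).
Proof.
move=> a; rewrite /lambda /lambdaV -amap_comp.
have -> : finv (lamM m) \o lamM m = id.
  by apply/funext => x /=; rewrite finv_f //; apply: lamM_inj.
exact: amap_id.
Qed.

Lemma lambdaVK (m : M) : cancel (lambdaV m) (lambda m).
Proof.
move=> a; rewrite /lambda /lambdaV -amap_comp.
have -> : lamM m \o finv (lamM m) = id.
  by apply/funext => x /=; rewrite f_finv //; apply: lamM_inj.
exact: amap_id.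
Qed.

Lemma pi_word_cat s t :
  pi_word r (s ++ t) = pi_word r s * amap (lam_word r s) (pi_word r t).
Proof.
elim: s => [|x s IH] /=; first by rewrite mul1g amap_id.
by rewrite IH amapM amap_comp mulgA.
Qed.

Lemma pi_word_cong s t : quad_cong r s t -> pi_word r s = pi_word r t.
Proof.
elim=> {s t} [s|s t _ IH|s t u _ IH1 _ IH2|u v x y] //; first by rewrite IH1.
rewrite !pi_word_cat; congr (_ * amap _ (_ * _)).
  rewrite /= !amap1 !mulg1 !amap_gen genA_mul.
  by rewrite -/(rho r y x) -/(lam r x y) lam_idem.
congr (amap _ _); apply/funext/lam_word_cong.
exact: (quad_step r [::] [::]).
Qed.

Lemma piA_class s : piA (quad_class r s : M) = pi_word r s.
Proof. exact/pi_word_cong/quad_reprP. Qed.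

Lemma piA1 : piA (1 : M) = 1.
Proof. exact: piA_class. Qed.

Lemma piA_gen x : piA (genM r x) = genA x.
Proof. by rewrite /genM piA_class /= amap1 mulg1. Qed.

Lemma piAM (m n : M) : piA (m * n) = piA m * lambda m (piA n).
Proof.
rewrite /lambda; elim/quad_classW: m => s; elim/quad_classW: n => t.
by rewrite -[_ * _]quad_class_cat !piA_class lamM_class pi_word_cat.
Qed.

(* The inverse of [pi_word], with fuel. *)
Fixpoint inv_word (k : nat) (w : seq X) : M :=
  if k isn't k'.+1 then 1 else
  if w is x :: w' then genM r x * inv_word k' (map (finv (l x)) w') else 1.

Lemma inv_step x y :
  genM r x * genM r (finv (l x) y) = genM r y * genM r (finv (l y) y).
Proof.
rewrite [LHS]quad_genM -/(lam r _ _) f_finv; last exact: lam_inj.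
congr (_ * gen r _).
apply: (@lam_inj y); rewrite f_finv; last exact: lam_inj.
set z := finv (l x) y; have zE : l x z = y by rewrite f_finv //; apply: lam_inj.
by rewrite -[in LHS]zE; have := lam_idem x z; rewrite zE.
Qed.

Lemma inv_step_lam x y z :
  finv (l (finv (l x) y)) (finv (l x) z) = finv (l (finv (l y) y)) (finv (l y) z).
Proof.
have E t : l x (l (finv (l x) y) t) = l y (l (finv (l y) y) t).
  have /(congr1 (@lamM X r)) := inv_step x y.
  by rewrite !lamMM !lamM_gen => /(congr1 (fun g => g t)).
apply: (@lam_inj (finv (l x) y)); apply: (@lam_inj x).
by rewrite [RHS]E !f_finv //; apply: lam_inj.
Qed.

Lemma inv_word_cong s t : quad_cong (fun p : X * X => (p.2, p.2)) s t ->
  inv_word (size s) s = inv_word (size t) t.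
Proof.
elim=> {s t} [s|s t _ IH|s t u _ IH1 _ IH2|u v x y] //; first by rewrite IH1.
rewrite !size_cat /= !addnS.
move: (size u + size v)%N (leq_addr (size v) (size u)) => k.
elim: k u v x y => [|k IH] [|a u] v x y //= uk; last first.
  by congr (_ * _); rewrite !map_cat /=; apply: IH; rewrite size_map.
  rewrite !mulgA inv_step -!map_comp.
  rewrite (@eq_map _ _ _ (finv (l (finv (l y) y)) \o finv (l y))) // => z /=.
  exact: inv_step_lam.
by rewrite !mulgA inv_step.
Qed.

Lemma pi_inv_word s : piA (inv_word (size s) s) = quad_class _ s.
Proof.
have [k] := ubnP (size s); elim: k s => // k IH [|x s] /=.
  by move=> _; rewrite piA1.
rewrite ltnS => sk; have := IH (map (finv (l x)) s).
rewrite size_map => /(_ sk) E.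
rewrite piAM piA_gen E /lambda lamM_gen amap_class -map_comp.
rewrite (@eq_map _ _ _ id) ?map_id; first by rewrite [RHS]quad_cons.
by move=> z /=; rewrite f_finv //; apply: lam_inj.
Qed.

Lemma genM_ind (P : M -> Prop) :
  P 1 -> (forall x m, P m -> P (genM r x * m)) -> forall m, P m.
Proof. exact: quad_ind. Qed.

Definition inv_piA (a : A) : M := inv_word (size (quad_repr a)) (quad_repr a).

Lemma inv_piA_class s : inv_piA (quad_class _ s) = inv_word (size s) s.
Proof. exact/inv_word_cong/quad_reprP. Qed.

Lemma inv_piA_gen x a : inv_piA (genA x * amap (l x) a) = genM r x * inv_piA a.
Proof.
elim/quad_classW: a => s.
rewrite amap_class -[_ * _]quad_cons !inv_piA_class /= size_map -map_comp.
congr (_ * inv_word _ _); rewrite (@eq_map _ _ _ id) ?map_id //.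
by move=> z /=; rewrite finv_f //; apply: lam_inj.
Qed.

Lemma inv_piA_pi : cancel (@piA X r) inv_piA.
Proof.
elim/genM_ind => [|x m IH]; first by rewrite piA1 [LHS]inv_piA_class.
by rewrite piAM piA_gen /lambda lamM_gen inv_piA_gen IH.
Qed.

Lemma piA_inv_piA : cancel inv_piA (@piA X r).
Proof. by elim/quad_classW=> s; rewrite inv_piA_class pi_inv_word. Qed.

Lemma piA_bij : bijective (@piA X r).
Proof. exact: Bijective inv_piA_pi piA_inv_piA. Qed.

Lemma eltK : cancel (@elt X r) (@piA X r).
Proof.
move=> a; rewrite /elt; case: xgetP => [m _ //|/(_ (inv_piA a))].
by rewrite /= piA_inv_piA.
Qed.

Lemma piAK : cancel (@piA X r) (@elt X r).
Proof. by move=> m; apply: (bij_inj piA_bij); rewrite eltK. Qed.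

End StructureTheory.

(* A (two-sided) group of quotients of the subsemigroup [S] of [M]: the values
   of [i] outside of [S] are irrelevant. *)
Definition group_of_quotients (M : monoidType) (S : set M) (G : groupType)
    (i : M -> G) : Prop :=
  [/\ forall s t, S s -> S t -> i (s * t) = i s * i t,
      forall s t, S s -> S t -> i s = i t -> s = t,
      forall g, exists s t, [/\ S s, S t & g = i s * (i t)^-1] &
      forall g, exists s t, [/\ S s, S t & g = (i t)^-1 * i s]].

Definition isomorphic (G H : groupType) : Prop :=
  exists f : {multiplicative G -> H}, bijective f.

Definition FC_group (G : groupType) : Prop :=
  forall g : G, finite_set [set g ^ h | h in [set: G]].

Definition torsion (G : groupType) : set G :=
  [set g | exists2 n, (0 < n)%N & g ^+ n = 1].
Arguments torsion : clear implicits.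

Definition subgroup_type (G : groupType) (H : groupClosed G) : Type :=
  {x : G | x \in H}.
HB.instance Definition _ (G : groupType) (H : groupClosed G) :=
  [isSub of subgroup_type H for @sval _ _].
HB.instance Definition _ (G : groupType) (H : groupClosed G) :=
  [Choice of subgroup_type H by <:].

Fact groupClosed_closed (G : groupType) (H : groupClosed G) :
  group_closed (fun x => x \in H).
Proof. by split; [apply: gpred1|move=> x y xH yH; apply: gpredF]. Qed.

HB.instance Definition _ (G : groupType) (H : groupClosed G) :=
  SubChoice_isSubGroup.Build G _ (subgroup_type H) (groupClosed_closed H).

Record normal_subgroup (G : groupType) := NormalSubgroup {
  ns_group :> groupClosed G;
  ns_normal : forall x y : G, x \in ns_group -> x ^ y \in ns_group }.

Section QuotientGroup.
Variables (G : groupType) (N : normal_subgroup G).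
Implicit Types x y : G.

Definition coset_rel : rel G := [rel x y | x^-1 * y \in N].

Lemma coset_rel_equiv : equiv_class_of coset_rel.
Proof.
split=> [x|x y|y x z]; rewrite /coset_rel /=; first by rewrite mulVg gpred1.
- by rewrite -(gpredV N (x^-1 * y)) invgM invgK.
- move=> xy yz; have -> : x^-1 * z = (x^-1 * y) * (y^-1 * z).
    by rewrite -mulgA (mulgA y) mulgV mul1g.
  exact: gpredM.
Qed.

Canonical coset_equiv := EquivRelPack coset_rel_equiv.

Definition quotient_group : Type := {eq_quot coset_rel}.
HB.instance Definition _ := EqQuotient.on quotient_group.
HB.instance Definition _ := Choice.on quotient_group.

Definition coset_class x : quotient_group := \pi_quotient_group x.
Definition coset_repr (A : quotient_group) : G := repr A.

Lemma coset_reprK : cancel coset_repr coset_class.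
Proof. exact: reprK. Qed.

Lemma coset_classP x y : x^-1 * y \in N <-> coset_class x = coset_class y.
Proof.
have P := @eqquotP _ coset_rel quotient_group x y.
by split=> [H|/P //]; apply/P.
Qed.

Lemma coset_classW (P : quotient_group -> Prop) :
  (forall x, P (coset_class x)) -> forall A, P A.
Proof. by move=> Px A; rewrite -[A]coset_reprK. Qed.

Lemma coset_reprP x : (coset_repr (coset_class x))^-1 * x \in N.
Proof. by apply/coset_classP; rewrite coset_reprK. Qed.

Definition coset_one : quotient_group := coset_class 1.
Definition coset_mul (A B : quotient_group) : quotient_group :=
  coset_class (coset_repr A * coset_repr B).
Definition coset_inv (A : quotient_group) : quotient_group :=
  coset_class (coset_repr A)^-1.

Lemma coset_mulE x y :
  coset_mul (coset_class x) (coset_class y) = coset_class (x * y).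
Proof.
apply/coset_classP; set x' := coset_repr _; set y' := coset_repr _.
have -> : (x' * y')^-1 * (x * y) = (x'^-1 * x) ^ y' * (y'^-1 * y).
  by rewrite /conjg invgM -!mulgA (mulgA y') mulgV mul1g.
by rewrite gpredM ?ns_normal ?coset_reprP.
Qed.

Lemma coset_invE x : coset_inv (coset_class x) = coset_class x^-1.
Proof.
apply/coset_classP; rewrite invgK; set x' := coset_repr _.
have -> : x' * x^-1 = ((x'^-1 * x) ^ x'^-1)^-1.
  by rewrite /conjg !invgM !invgK -!mulgA mulgV mulg1.
by rewrite gpredV ns_normal ?coset_reprP.
Qed.

Lemma coset_mulA : associative coset_mul.
Proof.
elim/coset_classW=> x; elim/coset_classW=> y; elim/coset_classW=> z.
by rewrite !coset_mulE mulgA.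
Qed.

Lemma coset_mul1 : left_id coset_one coset_mul.
Proof. by elim/coset_classW=> x; rewrite coset_mulE mul1g. Qed.

Lemma coset_mulr1 : right_id coset_one coset_mul.
Proof. by elim/coset_classW=> x; rewrite coset_mulE mulg1. Qed.

Lemma coset_mulV : left_inverse coset_one coset_inv coset_mul.
Proof. by elim/coset_classW=> x; rewrite coset_invE coset_mulE mulVg. Qed.

Lemma coset_mulrV : right_inverse coset_one coset_inv coset_mul.
Proof. by elim/coset_classW=> x; rewrite coset_invE coset_mulE mulgV. Qed.

HB.instance Definition _ := isGroup.Build quotient_group
  coset_mulA coset_mul1 coset_mulr1 coset_mulV coset_mulrV.

End QuotientGroup.

(* The additive group of integers, with its operation written as a product. *)
Notation Zgroup := (GRing.to_multiplicative int).

Section IntPower.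
Variables (G : groupType) (x : G).

Definition zpow (k : Zgroup) : G :=
  match k : int with Posz n => x ^+ n | Negz n => x ^- n.+1 end.

Let zpowS (k : int) : zpow (k + 1)%R = zpow k * x.
Proof.
case: k => [n|[|n]].
- by rewrite (_ : (Posz n + 1)%R = Posz n.+1) /= ?expgSr // -PoszD addn1.
- by rewrite [RHS]/= expg1 mulVg.
- rewrite (_ : (Negz n.+1 + 1)%R = Negz n) /=; last first.
    by rewrite !NegzE -[n.+2]addn1 PoszD GRing.opprD GRing.addrNK.
  by rewrite [in RHS]expgS invgM -mulgA mulVg mulg1.
Qed.

Lemma zpowM : {morph zpow : k l / k * l}.
Proof.
move=> k l; rewrite -[k * l]/((k : int) + (l : int))%R.
elim/int_ind: (l : int) => [|n IH|n IH].
- by rewrite GRing.addr0 mulg1.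
- by rewrite -addn1 PoszD GRing.addrA !zpowS IH mulgA.
- apply: (@mulIg _ x); rewrite -zpowS -mulgA -zpowS.
  rewrite -addn1 PoszD GRing.opprD.
  by rewrite -[(_ + _ + 1)%R]GRing.addrA GRing.addrNK IH.
Qed.

HB.instance Definition _ := isMultiplicative.Build Zgroup G zpow zpowM.

Definition gr : {pred G} := fun g => `[< exists k : Zgroup, g = zpow k >].

Lemma gr_mulg : mulg_closed gr.
Proof.
move=> a b /asboolP[k ->] /asboolP[l ->].
by apply/asboolP; exists (k * l); rewrite zpowM.
Qed.

Lemma gr1 : 1 \in gr.
Proof. by apply/asboolP; exists (0%R : int). Qed.

Lemma gr_invg : invg_closed gr.
Proof.
move=> a /asboolP[k ->]; apply/asboolP; exists k^-1.
by apply: (@mulIg _ (zpow k)); rewrite mulVg -zpowM mulVg.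
Qed.

HB.instance Definition _ := isMulClosed.Build G gr gr_mulg.
HB.instance Definition _ := isMul1Closed.Build G gr gr1.
HB.instance Definition _ := isInvClosed.Build G gr gr_invg.

End IntPower.

Record group_action (H N : groupType) := GroupAction {
  gact :> H -> N -> N;
  gactM : forall h, {morph gact h : m n / m * n};
  gact1 : forall n, gact 1 n = n;
  gact_comp : forall h k n, gact (h * k) n = gact h (gact k n) }.

Section SemidirectProduct.
Variables (H N : groupType) (sigma : group_action H N).

(* The unused argument records the action, on which the product depends. *)
Definition semidirect (s : group_action H N) : Type := (N * H)%type.
HB.instance Definition _ := Choice.on (semidirect sigma).

Definition sd_one : semidirect sigma := (1, 1).
Definition sd_mul (a b : semidirect sigma) : semidirect sigma :=
  (a.1 * sigma a.2 b.1, a.2 * b.2).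
Definition sd_inv (a : semidirect sigma) : semidirect sigma :=
  (sigma a.2^-1 a.1^-1, a.2^-1).

Let sigma1 h : sigma h 1 = 1.
Proof. by apply: (@mulgI _ (sigma h 1)); rewrite -gactM !mulg1. Qed.

Lemma sd_mulA : associative sd_mul.
Proof.
by move=> a b c; rewrite /sd_mul /= gactM gact_comp !mulgA.
Qed.

Lemma sd_mul1 : left_id sd_one sd_mul.
Proof. by case=> n h; rewrite /sd_mul /= gact1 !mul1g. Qed.

Lemma sd_mulr1 : right_id sd_one sd_mul.
Proof. by case=> n h; rewrite /sd_mul /= sigma1 !mulg1. Qed.

Lemma sd_mulV : left_inverse sd_one sd_inv sd_mul.
Proof.
by case=> n h; rewrite /sd_mul /sd_inv /= -gactM !mulVg sigma1.
Qed.

Lemma sd_mulrV : right_inverse sd_one sd_inv sd_mul.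
Proof.
by case=> n h; rewrite /sd_mul /sd_inv /= -gact_comp !mulgV gact1 mulgV.
Qed.

HB.instance Definition _ := isGroup.Build (semidirect sigma)
  sd_mulA sd_mul1 sd_mulr1 sd_mulV sd_mulrV.

End SemidirectProduct.

Section ConjugationAction.
Variables (G H : groupType) (N : normal_subgroup G).
Variable phi : {multiplicative H -> G}.

Definition conj_fun (h : H) (n : subgroup_type N) : subgroup_type N :=
  exist _ (val n ^ (phi h)^-1) (ns_normal (phi h)^-1 (valP n)).

Lemma conj_funM h : {morph conj_fun h : m n / m * n}.
Proof. by move=> m n; apply: val_inj; rewrite /= conjMg. Qed.

Let phi1 : phi 1 = 1.
Proof. by apply: (@mulgI _ (phi 1)); rewrite -gmulfM !mulg1. Qed.

Lemma conj_fun1 n : conj_fun 1 n = n.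
Proof. by apply: val_inj; rewrite /= phi1 invg1 conjg1. Qed.

Lemma conj_fun_comp h k n : conj_fun (h * k) n = conj_fun h (conj_fun k n).
Proof. by apply: val_inj; rewrite /= gmulfM invgM conjgM. Qed.

(* [h] acts on [N] by n |-> phi h * n * (phi h)^-1. *)
Definition conj_action : group_action H (subgroup_type N) :=
  GroupAction conj_funM conj_fun1 conj_fun_comp.

End ConjugationAction.

(* Main.v *)
(* Write an element of S_u as (n y, lambda). Since y = lambda(u), it is
   determined by its length n and by lambda, so S_u embeds in int * Sym(X). If x
   is a generator in S_u, that is q(x) = u, then x^d is the element (d, id) of
   int * Sym(X): it is c_u, it is central, and s^d = c_u^|s| for every s in S_u,
   so that all denominators may be taken to be powers of c_u. The length thus
   extends to a homomorphism G_u -> int, whose kernel embeds in Sym(X) and which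
   maps x to 1. Every group with a homomorphism to int of finite kernel that maps
   some element to 1 is FC and splits as claimed. *)
Require Import Defs.
From HB Require Import structures.
From mathcomp Require Import fingroup perm abelian.
From mathcomp Require Import all_boot all_order ssralg ssrnum ssrint.
From mathcomp Require Import boolp classical_sets cardinality.

Set Implicit Arguments.
Unset Strict Implicit.
Unset Printing Implicit Defensive.

Local Open Scope classical_set_scope.
Local Open Scope group_scope.

(** * Groups with a finite normal subgroup and infinite cyclic quotient *)

Lemma isomorphic_morph (G H : groupType) (f : G -> H) :
  {morph f : x y / x * y} -> bijective f -> isomorphic G H.
Proof.
move=> fM fB.
exists (HB.pack_for {multiplicative G -> H} f
  (isMultiplicative.Build _ _ f fM)).
exact: fB.
Qed.

Lemma morph_group1 (G H : groupType) (f : {multiplicative G -> H}) : f 1 = 1.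
Proof. by apply: (@mulgI _ (f 1)); rewrite -gmulfM !mulg1. Qed.

Lemma morph_groupV (G H : groupType) (f : {multiplicative G -> H}) :
  {morph f : x / x^-1}.
Proof.
by move=> x; apply: (@mulIg _ (f x)); rewrite -gmulfM !mulVg morph_group1.
Qed.

(** * Kernels of morphisms: quotients and splittings *)

Section Kernel.
Variables (G H : groupType) (f : {multiplicative G -> H}).

Definition mker : {pred G} := fun g => f g == 1.

Lemma mkerP g : reflect (f g = 1) (g \in mker).
Proof. exact: eqP. Qed.

Lemma mker_mulg : mulg_closed mker.
Proof.
by move=> x y /mkerP fx /mkerP fy; apply/mkerP; rewrite gmulfM fx fy mulg1.
Qed.

Lemma mker1 : 1 \in mker.
Proof. exact/mkerP/morph_group1. Qed.

Lemma mker_invg : invg_closed mker.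
Proof. by move=> x /mkerP fx; apply/mkerP; rewrite morph_groupV fx invg1. Qed.

HB.instance Definition _ := isMulClosed.Build G mker mker_mulg.
HB.instance Definition _ := isMul1Closed.Build G mker mker1.
HB.instance Definition _ := isInvClosed.Build G mker mker_invg.

Lemma mkerJ x y : x \in mker -> x ^ y \in mker.
Proof.
move=> /mkerP fx; apply/mkerP.
by rewrite /conjg !gmulfM fx mul1g morph_groupV mulVg.
Qed.

Definition mker_normal : normal_subgroup G := NormalSubgroup mkerJ.

Lemma quotient_mker : (forall h, exists g, f g = h) ->
  isomorphic (quotient_group mker_normal) H.
Proof.
move=> f_surj; pose F (A : quotient_group mker_normal) := f (coset_repr A).
have FE x : F (coset_class mker_normal x) = f x.
  have /mkerP := coset_reprP mker_normal x.
  by rewrite gmulfM morph_groupV => /mulg1_eq; rewrite invgK.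
apply: (@isomorphic_morph _ _ F).
  elim/coset_classW=> x; elim/coset_classW=> y.
  by rewrite [_ * _]coset_mulE !FE gmulfM.
have [g gE] := choice f_surj.
exists (fun h => coset_class mker_normal (g h)) => [|h]; last by rewrite FE.
elim/coset_classW=> x; rewrite FE; apply/coset_classP/mkerP.
by rewrite gmulfM morph_groupV gE mulVg.
Qed.

(** The section [phi] splits every [x] as [x * (phi (f x))^-1], which lies in the kernel, times
    [phi (f x)]. Only the elements of [T] are prescribed, so that one [T] can serve for several
    morphisms with the same kernel. *)
Lemma semidirect_mker (phi : {multiplicative H -> G}) : cancel phi f ->
  forall T : normal_subgroup G, T =i mker ->
  isomorphic G (semidirect (conj_action T phi)).
Proof.
move=> phiK T TE.
have Tx x : x * (phi (f x))^-1 \in T.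
  by rewrite TE; apply/mkerP; rewrite gmulfM morph_groupV phiK mulgV.
pose F x : semidirect (conj_action T phi) :=
  (exist (fun y => y \in T) _ (Tx x), f x).
apply: (@isomorphic_morph _ _ F).
  move=> x y; rewrite /F; congr (_, _); last exact: gmulfM.
  apply: val_inj; rewrite /= /conjg !gmulfM invgK invgM.
  by rewrite !mulgA mulgVK.
exists (fun p => val p.1 * phi p.2) => [x|[[n nT] h]] /=; first by rewrite mulgVK.
have /mkerP fn : n \in mker by rewrite -TE.
have fE : f (n * phi h) = h by rewrite gmulfM fn mul1g phiK.
rewrite /F; congr (_, _) => //; apply: val_inj => /=.
by rewrite fE mulgK.
Qed.

End Kernel.

(** Otherwise the powers of [g] would be pairwise distinct and embed the natural numbers in the
    finite set [T]. *)
Lemma finite_order (G : groupType) (T : set G) (g : G) :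
  finite_set T -> (forall n, T (g ^+ n)) -> torsion G g.
Proof.
move=> finT Tg; apply: contrapT => ntors.
have g_inj : injective (fun n => g ^+ n).
  suff le m n : (m < n)%N -> g ^+ m <> g ^+ n.
    by move=> m n /= gmn; case: (ltngtP m n) => // /le; rewrite gmn.
  move=> mn gmn; apply: ntors; exists (n - m)%N; first by rewrite subn_gt0.
  by apply: (@mulgI _ (g ^+ m)); rewrite -expgnDr subnKC ?mulg1 // ltnW.
apply: infinite_nat; rewrite (_ : [set: nat] = (fun n => g ^+ n) @^-1` T).
  by apply: finite_preimage => // m n _ _; apply: g_inj.
by apply/seteqP; split=> n _ //; apply: Tg.
Qed.

(** * Morphisms to the integers with finite kernel *)

Section FiniteByZ.
Variables (G : groupType) (deg : {multiplicative G -> Zgroup}) (g : G).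
Hypotheses (fin_ker : finite_set [set` mker deg]) (deg_g : deg g = (1%R : int)).

Lemma deg_zpow : cancel (zpow g) deg.
Proof.
have degX n : deg (g ^+ n) = Posz n.
  elim: n => [|n IH]; first exact: morph_group1.
  by rewrite expgS gmulfM IH deg_g -add1n PoszD.
by case=> n /=; rewrite ?morph_groupV degX ?NegzE.
Qed.

(** Powers of an element of the kernel stay in the finite kernel; conversely, the integers are
    torsion-free. *)
Lemma torsion_mker : [set` mker deg] = torsion G.
Proof.
apply/seteqP; split=> [x /= xT|x [n n_gt0 xn]].
  by apply: finite_order fin_ker _ => n /=; apply: gpredXn.
apply/mkerP; have degX m : deg (x ^+ m) = ((deg x : int) *+ m)%R.
  elim: m => [|m IH]; first exact: morph_group1.
  by rewrite expgS gmulfM IH GRing.mulrS.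
have /eqP := degX n; rewrite xn morph_group1 eq_sym.
by rewrite Num.Theory.mulrn_eq0 eqn0Ngt n_gt0 => /eqP.
Qed.

(* The degree takes values in an abelian group, so the conjugates of [x] lie in
   the coset of the kernel through [x]. *)
Lemma finite_by_Z_FC : FC_group G.
Proof.
move=> x; apply: (@sub_finite_set _ _ [set x * n | n in [set` mker deg]]).
  move=> _ [h _ <-]; exists (x^-1 * x ^ h); last by rewrite mulVKg.
  apply/mkerP; rewrite gmulfM -[x ^ h]/(h^-1 * (x * h)) !gmulfM !morph_groupV.
  by rewrite (GRing.commuteT (deg x)) mulKg mulVg.
exact: finite_image.
Qed.

Lemma finite_by_Z_split : let T := mker_normal deg in
  [/\ [set` T] = torsion G, finite_set [set` T],
      isomorphic (quotient_group T) Zgroup,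
      forall y : quotient_group T, y \in gr (coset_class T g)
    & isomorphic G (semidirect (conj_action T (val : subgroup_type (gr g) -> G)))
      /\ isomorphic G (semidirect (conj_action T (zpow g)))].
Proof.
move=> T; split=> //.
- exact: torsion_mker.
- by apply: quotient_mker => k; exists (zpow g k); apply: deg_zpow.
- have coset_zpow k : zpow (coset_class T g) k = coset_class T (zpow g k).
    have cosetX n : coset_class T g ^+ n = coset_class T (g ^+ n).
      by elim: n => // n IH; rewrite !expgS IH [LHS]coset_mulE.
    by case: k => n //=; rewrite cosetX [LHS]coset_invE.
  elim/coset_classW=> x; apply/asboolP; exists (deg x); rewrite coset_zpow.
  by apply/coset_classP/mkerP; rewrite gmulfM morph_groupV deg_zpow mulVg.
- split; last exact: (semidirect_mker deg_zpow).
  (* Replacing [deg x] by its power [zpow g (deg x)] gives a morphism onto [gr g] with the same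
     kernel [T], and the inclusion of [gr g] is a section of it. *)
  have grX x : zpow g (deg x) \in gr g by apply/asboolP; exists (deg x).
  pose f x : subgroup_type (gr g) := exist (fun y => y \in gr g) _ (grX x).
  have fM : {morph f : x y / x * y}.
    by move=> x y; apply: val_inj; rewrite /= gmulfM zpowM.
  pose F := HB.pack_for {multiplicative G -> subgroup_type (gr g)} f
    (isMultiplicative.Build _ _ f fM).
  apply: (@semidirect_mker _ _ F) => [[h /= hg]|x].
    by apply: val_inj => /=; case/asboolP: hg => k ->; rewrite deg_zpow.
  apply/mkerP/mkerP => [dx|/(congr1 val) /= zx]; last first.
    by rewrite -[LHS]deg_zpow zx morph_group1.
  by apply: val_inj => /=; rewrite dx.
Qed.

End FiniteByZ.

(** * The semigroups S_u *)

Section DerivedMonoid.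
Variable X : finType.
Implicit Types (x y : X) (a : derived_monoid X).

Lemma genA_mulX x y n : genA x * genA y ^+ n.+1 = genA y ^+ n.+2.
Proof. by rewrite expgS mulgA genA_mul -mulgA -!expgS. Qed.

(** Each letter can overwrite the one before it, so the last letter overwrites all of [a]. *)
Lemma mul_genA a x : a * genA x = genA x ^+ (lenA a).+1.
Proof.
elim/genA_ind: a => [|y a IH]; first by rewrite mul1g [lenA _]len1.
by rewrite -mulgA IH genA_mulX [lenA (_ * _)]lenM [len (genA y)]len_gen.
Qed.

Lemma mul_genAX a x n : a * genA x ^+ n.+1 = genA x ^+ (lenA a + n.+1).
Proof.
by rewrite expgS mulgA mul_genA -expgnDr addSnnS.
Qed.

(** The last letter of a word is invariant under the relations x + y = y + y. *)
Lemma genAX_inj x y n : genA x ^+ n.+1 = genA y ^+ n.+1 -> x = y.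
Proof.
have last_cong s t : quad_cong (fun p : X * X => (p.2, p.2)) s t ->
    last x s = last x t.
  elim=> {s t} [s|s t _ ->|s t u _ -> _ ->|u v a b] //.
  by rewrite !last_cat; case: v.
have powE z : genA z ^+ n.+1 = quad_class _ (nseq n.+1 z).
  by elim: n.+1 => // m IH; rewrite expgS IH -quad_cons.
have lastE z : last x (nseq n.+1 z) = z by rewrite /=; elim: n {powE}.
by rewrite !powE => /quad_classP/last_cong; rewrite !lastE.
Qed.

End DerivedMonoid.

(** * Length, permutations and membership in S_u *)

Section Solution.
Variables (X : finType) (r : X * X -> X * X).
Hypotheses (ybe : yang_baxter r) (lnd : left_nondegenerate r).
Hypothesis idem : idempotent_fun r.
Local Notation M := (structure_monoid r).
Implicit Types (m n s t : M) (u v x y : X).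

Lemma len_lambda m (a : derived_monoid X) : lenA (lambda m a) = lenA a.
Proof. exact: lenA_amap. Qed.

Lemma lenA_piA m : lenA (piA m) = len m.
Proof.
elim/genM_ind: m => [|x m IH]; first by rewrite piA1 // [RHS]len1 [LHS]len1.
rewrite piAM // [LHS]lenM [X in (_ + X)%N]len_lambda IH piA_gen //.
by rewrite [RHS]lenM [len (genA x)]len_gen [len (genM r x)]len_gen.
Qed.

Lemma lambda_genAX m x k : lambda m (genA x ^+ k) = genA (lamM m x) ^+ k.
Proof.
rewrite /lambda; elim: k => [|k IH]; first exact: amap1.
by rewrite !expgS amapM IH amap_gen.
Qed.

Lemma len_eq0 m : len m = 0%N -> m = 1.
Proof.
elim/genM_ind: m => // x m _.
by rewrite [len _]lenM [len (genM r x)]len_gen.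
Qed.

(** Applying lambda_m to the defining equation removes the inverse, and [m <> 1] becomes positive
    length because only 1 has length 0. *)
Lemma S_P u m :
  S_ r u m <-> (0 < len m)%N /\ piA m = genA (lamM m u) ^+ len m.
Proof.
rewrite /S_ /structure_semigroup /= lenA_piA lt0n -lambda_genAX.
split=> [[m1 <-]|[m0 piE]]; rewrite ?lambdaVK //.
  by split=> //; apply/eqP => /len_eq0.
split; last by rewrite piE lambdaK.
by move=> m1; move: m0; rewrite m1 [len _]len1.
Qed.

(* [m] lies in [S_u] iff [u = q(x)] for the last letter [x] of [m]. *)
Lemma S_mul_gen m x : S_ r (diag r x) (m * genM r x).
Proof.
apply/S_P; rewrite [len _]lenM [len (genM r x)]len_gen addn1; split=> //.
rewrite piAM // piA_gen // -[genA x]expg1 lambda_genAX mul_genA lenA_piA.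
rewrite lamMM // lamM_gen //= /diag f_finv //; exact: lam_inj.
Qed.

Lemma S_diag m : structure_semigroup r m -> exists2 u, u \in Lambda r & S_ r u m.
Proof.
elim/quad_classW: m => s; case/lastP: s => [//|s x] _.
exists (diag r x); first by apply/imsetP; exists x.
by rewrite -cats1 quad_class_cat; apply: S_mul_gen.
Qed.

Lemma S_gen u : u \in Lambda r -> exists x, S_ r u (genM r x).
Proof.
by case/imsetP=> x _ ->; exists x; rewrite -[genM r x]mul1g; apply: S_mul_gen.
Qed.

(** S_u is a left ideal of [M]: adding |n| y with |n| > 0 on the right of pi(m) overwrites pi(m),
    leaving only its length. *)
Lemma S_mull u m n : S_ r u n -> S_ r u (m * n).
Proof.
move=> /S_P[n0 piE]; apply/S_P; rewrite [len _]lenM addn_gt0 n0 orbT; split=> //.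
rewrite piAM // piE lambda_genAX lamMM //=.
by case: (len n) n0 => // k _; rewrite mul_genAX lenA_piA.
Qed.

Lemma S_exp u m k : S_ r u m -> S_ r u (m ^+ k.+1).
Proof. by rewrite expgSr; apply: S_mull. Qed.

Lemma S_semigroup u m : S_ r u m -> structure_semigroup r m.
Proof. by case. Qed.

(* An element (n y, lambda) of [S_u] is determined by [n] and [lambda], because
   y = lambda(u): so [S_u] embeds in [int * Sym(X)]. *)
Lemma S_inj u m n : S_ r u m -> S_ r u n ->
  len m = len n -> lamM m = lamM n -> m = n.
Proof.
move=> /S_P[_ mE] /S_P[_ nE] lenmn lammn.
by apply: (bij_inj (piA_bij ybe lnd idem)); rewrite mE nE lenmn lammn.
Qed.

Lemma len_exp m k : len (m ^+ k) = (k * len m)%N.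
Proof.
by elim: k => [|k IH]; [exact: len1 | rewrite expgS [len _]lenM IH mulSn].
Qed.

(* The inverse makes [lam_perm] multiplicative, as products of permutations are
   composed from left to right. *)
Definition lam_perm m : {perm X} := (perm (lamM_inj lnd (m := m)))^-1.

Lemma lam_permM : {morph lam_perm : m n / m * n}.
Proof.
move=> m n; rewrite /lam_perm -invgM; congr _^-1.
by apply/perm.permP=> x; rewrite permM !permE lamMM.
Qed.

Lemma lam_perm1 : lam_perm 1 = 1.
Proof. by apply: (@mulgI _ (lam_perm 1)); rewrite -lam_permM !mulg1. Qed.

Lemma lam_permX m k : lam_perm (m ^+ k) = lam_perm m ^+ k.
Proof.
elim: k => [|k IH]; first by rewrite lam_perm1.
by rewrite !expgS lam_permM IH.
Qed.

Lemma lam_perm_eq m n : lam_perm m = lam_perm n <-> lamM m = lamM n.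
Proof.
split=> [/invg_inj mn|mn].
  by apply/funext=> x; have /perm.permP/(_ x) := mn; rewrite !permE.
by congr _^-1; apply/perm.permP=> x; rewrite !permE mn.
Qed.

Lemma lam_perm_group m : lam_perm m \in perm_group r.
Proof.
elim/genM_ind: m => [|x m IH]; first by rewrite lam_perm1 group1.
rewrite lam_permM groupM // groupV mem_gen // inE.
by apply/existsP; exists x; apply/forallP=> y; rewrite permE lamM_gen.
Qed.

Lemma S_perm_inj u m n : S_ r u m -> S_ r u n ->
  len m = len n -> lam_perm m = lam_perm n -> m = n.
Proof. by move=> Sm Sn lenmn /lam_perm_eq; apply: S_inj Sm Sn lenmn. Qed.

(** Both coordinates of the embedding, the length and the permutation, can be cancelled. *)
Lemma S_cancellative u : cancellative (S_ r u).
Proof.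
move=> a b c Sa Sb Sc; split=> abc; apply: (S_perm_inj Sb Sc).
- by have /(congr1 (@len _ _)) := abc; rewrite [LHS]lenM [RHS]lenM => /addnI.
- by have /(congr1 lam_perm) := abc; rewrite !lam_permM => /mulgI.
- by have /(congr1 (@len _ _)) := abc; rewrite [LHS]lenM [RHS]lenM => /addIn.
- by have /(congr1 lam_perm) := abc; rewrite !lam_permM => /mulIg.
Qed.

Variable d : nat.
Hypotheses (d_gt0 : (0 < d)%N) (d_exp : (exponent (perm_group r) %| d)%N).

Lemma lam_perm_expd m : lam_perm m ^+ d = 1.
Proof. exact: (exponentP d_exp _ (lam_perm_group m)). Qed.

(** * The central element c_u and the decomposition of S_u *)

Section CentralElement.
Variable u : X.
Hypothesis u_diag : u \in Lambda r.
Local Notation c := (c_ r d u).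

(** As the exponent divides [d], lambda is trivial on x^d, which therefore lies over d u. The
    definition of [c] only prescribes its image under [piA]; this form gives access to its length
    and its permutation. *)
Lemma c_genX x : S_ r u (genM r x) -> c = genM r x ^+ d.
Proof.
move=> Sx; have Sxd : S_ r u (genM r x ^+ d).
  by rewrite -(prednK d_gt0); apply: S_exp.
have lxd : lamM (genM r x ^+ d) = id.
  rewrite -(lamM1 ybe); apply/lam_perm_eq.
  by rewrite lam_permX lam_perm_expd lam_perm1.
have /S_P[_] := Sxd; rewrite lxd len_exp [len (genM r x)]len_gen muln1 => piE.
by rewrite /c_ -piE piAK.
Qed.

Lemma S_c : S_ r u c.
Proof.
have [x Sx] := S_gen u_diag; rewrite (c_genX Sx).
by rewrite -(prednK d_gt0); apply: S_exp.
Qed.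

Lemma len_c : len c = d.
Proof.
have [x Sx] := S_gen u_diag.
by rewrite (c_genX Sx) len_exp [len (genM r x)]len_gen muln1.
Qed.

Lemma lam_perm_c : lam_perm c = 1.
Proof.
by have [x Sx] := S_gen u_diag; rewrite (c_genX Sx) lam_permX lam_perm_expd.
Qed.

Lemma lamM_c : lamM c = id.
Proof.
by rewrite -(lamM1 ybe); apply/lam_perm_eq; rewrite lam_perm_c lam_perm1.
Qed.

Lemma lambda_c a : lambda c a = a.
Proof. by rewrite /lambda lamM_c amap_id. Qed.

Lemma c_central m : S_ r u m -> c * m = m * c.
Proof.
move=> Sm; apply: (@S_perm_inj u); [exact: S_mull|exact: S_mull S_c| |].
  by rewrite [LHS]lenM [RHS]lenM addnC.
by rewrite !lam_permM lam_perm_c mulg1 mul1g.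
Qed.

Lemma piA_c : piA c = genA u ^+ d.
Proof. by have /S_P[_] := S_c; rewrite lamM_c len_c. Qed.

Lemma lamM_cX k : lamM (c ^+ k) = id.
Proof.
rewrite -(lamM1 ybe); apply/lam_perm_eq.
by rewrite lam_permX lam_perm_c expg1n lam_perm1.
Qed.

Lemma len_cX k : len (c ^+ k) = (k * d)%N.
Proof. by rewrite len_exp len_c. Qed.

Lemma piA_cX_mul k m : piA (c ^+ k * m) = piA (c ^+ k) * piA m.
Proof. by rewrite piAM // /lambda lamM_cX amap_id. Qed.

(* Dividing [n y] by a power of [c] does not change [lambda]: [c_u^k] times the
   element over [j y] is the element over [(k d + j) y]. *)
Lemma S_decomposition :
  S_ r u = [set c ^+ k * f | k in [set: nat] & f in F_ r d u].
Proof.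
apply/seteqP; split=> [m Sm|_ [k _ [f [Sf _] <-]]]; last exact: S_mull.
have /S_P[m0 mE] := Sm.
(* The division is shifted by one so that the remainder [j] lies between 1 and [d]: elements of [F_]
   have positive length. *)
pose k := ((len m).-1 %/ d)%N; pose j := ((len m).-1 %% d).+1.
have mkj : len m = (k * d + j)%N by rewrite addnS -divn_eq prednK.
pose y := lamM m u; pose f : M := elt r (genA y ^+ j).
have fE : piA f = genA y ^+ j by rewrite eltK.
have cf : c ^+ k * f = m.
  apply: (bij_inj (piA_bij ybe lnd idem)); rewrite piA_cX_mul fE mE mul_genAX.
  by rewrite lenA_piA len_cX -[_.+1]/j -mkj.
have lf : len f = j by rewrite -lenA_piA fE lenA_genX.
exists k => //; exists f => //; split; last by rewrite /= lenA_piA lf ltn_mod.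
by apply/S_P; rewrite lf; split=> //; rewrite fE /y -cf lamMM // lamM_cX.
Qed.

(** Through pi, an element [m] of S_u is determined by its length, here at most [d], and the letter
    [lamM m u]. *)
Lemma finite_F : finite_set (F_ r d u).
Proof.
apply: (@sub_finite_set _ _
    [set elt r (genA p.2 ^+ val p.1) | p in [set: 'I_d.+1 * X]]).
  move=> m [/S_P[_ mE]]; rewrite lenA_piA => /andP[_ md].
  have lt_md : (len m < d.+1)%N by [].
  by exists (Ordinal lt_md, lamM m u) => //=; rewrite -mE piAK.
apply: finite_image; exact: finite_finset.
Qed.

End CentralElement.

(** If Lambda = {u}, then S is S_u. Conversely, c_u c_v = c_v c_v for all u, v in Lambda, so that
    cancelling c_v forces u = v. *)
Lemma cancellative_Lambda : (0 < #|X|)%N ->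
  cancellative (structure_semigroup r) <-> #|Lambda r| = 1%N.
Proof.
move=> /card_gt0P[x0 _]; split=> [canc|/eqP/cards1P[u LE]]; last first.
  move=> a b c Sa Sb Sc; apply: (@S_cancellative u).
  - by have [v] := S_diag Sa; rewrite LE inE => /eqP ->.
  - by have [v] := S_diag Sb; rewrite LE inE => /eqP ->.
  - by have [v] := S_diag Sc; rewrite LE inE => /eqP ->.
have L0 : diag r x0 \in Lambda r by apply/imsetP; exists x0.
apply/eqP/cards1P; exists (diag r x0); apply/setP=> u; rewrite inE.
apply/idP/eqP=> [Lu|->//]; move: (diag r x0) L0 => v Lv.
have Sc w : w \in Lambda r -> structure_semigroup r (c_ r d w).
  by move=> Lw; apply: S_semigroup (S_c Lw).
(* d u + d v = 2 d v = d v + d v *)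
have cuv : c_ r d u * c_ r d v = c_ r d v * c_ r d v.
  apply: (bij_inj (piA_bij ybe lnd idem)); rewrite !piAM // !lambda_c //.
  rewrite !piA_c // -(prednK d_gt0) !mul_genAX !lenA_genX //.
have [_ /(_ cuv)] := canc _ _ _ (Sc _ Lv) (Sc _ Lu) (Sc _ Lv).
by move/(congr1 (@piA X r)); rewrite !piA_c // -(prednK d_gt0) => /genAX_inj.
Qed.

(** * The group of quotients of S_u *)

Section Quotients.
Variable u : X.
Hypothesis u_diag : u \in Lambda r.
Local Notation c := (c_ r d u).

Lemma S_cX k : S_ r u (c ^+ k.+1).
Proof. exact: S_exp (S_c u_diag). Qed.

Lemma expd_len m : S_ r u m -> m ^+ d = c ^+ len m.
Proof.
move=> Sm; have /S_P[m0 _] := Sm.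
apply: (@S_perm_inj u).
- by rewrite -(prednK d_gt0); apply: S_exp.
- by rewrite -(prednK m0); apply: S_cX.
- by rewrite len_exp len_cX // mulnC.
- by rewrite !lam_permX lam_perm_c // expg1n lam_perm_expd.
Qed.

(** * A group of quotients inside the product of the integers and Sym(X) *)

Definition embed m : Zgroup * {perm X} := (Posz (len m), lam_perm m).

Lemma embedM : {morph embed : m n / m * n}.
Proof.
move=> m n; rewrite /embed lam_permM; congr (_, _).
by rewrite [len _]lenM PoszD.
Qed.

Lemma embed_inj m n : S_ r u m -> S_ r u n -> embed m = embed n -> m = n.
Proof. by move=> Sm Sn [lenmn]; apply: S_perm_inj Sm Sn lenmn. Qed.

Lemma embed_cX_commute k g : commute g (embed (c ^+ k)).
Proof.
have -> : embed (c ^+ k) = (Posz (k * d), 1).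
  by rewrite /embed lam_permX lam_perm_c // expg1n len_cX.
case: g => a b; congr (_, _); [exact: GRing.commuteT | exact: commute1].
Qed.

(** The fractions with numerator in S_u and denominator a power of c_u. The exponent is positive so
    that the denominator lies in S_u too. *)
Definition quotients : {pred Zgroup * {perm X}} :=
  fun g => `[< exists m k, S_ r u m /\ g * embed (c ^+ k.+1) = embed m >].

Lemma quotients_mulg : mulg_closed quotients.
Proof.
move=> g h /asboolP[m [k [Sm gE]]] /asboolP[n [l [Sn hE]]].
apply/asboolP; exists (m * n), (k + l.+1)%N; split; first exact: S_mull.
rewrite -addSn expgnDr !embedM -gE -hE -!mulgA; congr (_ * _).
by rewrite mulgA (embed_cX_commute k.+1 h) -mulgA.
Qed.

Lemma embed_quotients m : S_ r u m -> embed m \in quotients.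
Proof.
move=> Sm; apply/asboolP; exists (m * c), 0%N; rewrite expg1 embedM; split=> //.
exact: S_mull (S_c u_diag).
Qed.

Lemma quotients1 : 1 \in quotients.
Proof.
apply/asboolP; exists c, 0%N; rewrite expg1 mul1g; split=> //; exact: S_c.
Qed.

(** Since m^d = c^|m|, the inverse of m c^-(k+1) is m^(d-1) c^(k+1) c^-|m|. *)
Lemma quotients_invg : invg_closed quotients.
Proof.
move=> g /asboolP[m [k [Sm gE]]]; have /S_P[m0 _] := Sm.
apply/asboolP; exists (m ^+ d.-1 * c ^+ k.+1), (len m).-1.
split; first exact: S_mull (S_cX k).
rewrite prednK // -expd_len // -[X in m ^+ X](prednK d_gt0) expgS !embedM -gE.
by rewrite -mulgA mulKg embed_cX_commute.
Qed.

HB.instance Definition _ := isMulClosed.Build _ quotients quotients_mulg.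
HB.instance Definition _ := isMul1Closed.Build _ quotients quotients1.
HB.instance Definition _ := isInvClosed.Build _ quotients quotients_invg.

Lemma group_of_quotients_exists :
  exists (G : groupType) (i : M -> G), group_of_quotients (S_ r u) i.
Proof.
(* The default 1 is never taken on S_u, where [embed m] lies in [quotients]. *)
pose i m : subgroup_type quotients := insubd 1 (embed m).
have iE m : S_ r u m -> val (i m) = embed m.
  by move=> Sm; rewrite val_insubd embed_quotients.
exists (subgroup_type quotients), i; split.
- move=> s t Ss St; apply: val_inj; rewrite [RHS]/= !iE //; last exact: S_mull.
  exact: embedM.
- by move=> s t Ss St /(congr1 val); rewrite !iE //; apply: embed_inj.
- move=> g; have /asboolP[m [k [Sm gE]]] := valP g.
  exists m, (c ^+ k.+1); split=> //; first exact: S_cX.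
  apply: (@mulIg _ (i (c ^+ k.+1))); rewrite mulgVK; apply: val_inj.
  by rewrite [LHS]/= !iE //; apply: S_cX.
- move=> g; have /asboolP[m [k [Sm gE]]] := valP g.
  exists m, (c ^+ k.+1); split=> //; first exact: S_cX.
  apply: (@mulgI _ (i (c ^+ k.+1))); rewrite mulVKg; apply: val_inj.
  rewrite [LHS]/= !iE //; last exact: S_cX.
  by rewrite -gE embed_cX_commute.
Qed.

(** * The degree on an arbitrary group of quotients *)

Section Degree.
Variables (G : groupType) (i : M -> G).
Hypothesis quot : group_of_quotients (S_ r u) i.

Let iM s t : S_ r u s -> S_ r u t -> i (s * t) = i s * i t.
Proof. by case: quot => + _ _ _; apply. Qed.

Let i_inj s t : S_ r u s -> S_ r u t -> i s = i t -> s = t.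
Proof. by case: quot => _ + _ _; apply. Qed.

Definition fraction (g : G) m k := S_ r u m /\ g * i (c ^+ k.+1) = i m.

(** Powers of [c] commute with the image of S_u, hence with all quotients of its elements. *)
Lemma quot_cX_commute k g : commute g (i (c ^+ k.+1)).
Proof.
have comm s : S_ r u s -> commute (i (c ^+ k.+1)) (i s).
  move=> Ss; rewrite /commute -!iM //; try exact: S_cX; congr i.
  by apply/commute_sym/commuteX/commute_sym; apply: c_central Ss.
have [_ _ /(_ g)[s [t [Ss St ->]]] _] := quot.
apply: commute_sym; apply: commuteM; first exact: comm.
by apply: (@mulgI _ (i t)); rewrite mulgA -comm // -mulgA mulgV mulg1 mulVKg.
Qed.

Lemma fraction_exists g : exists p, fraction g p.1 p.2.
Proof.
have [_ _ /(_ g)[s [t [Ss St ->]]] _] := quot; have /S_P[t0 _] := St.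
(* For g = s t^-1, multiply by t^(2d) = c^(2|t|) to get the numerator s t^(2d-1). The exponent 2d -
   1 is positive even for d = 1, whereas t^(d-1) could be 1, outside of S_u, where nothing is known
   about [i]. *)
have d2 : (0 < d + d.-1)%N by rewrite addn_gt0 d_gt0.
exists (s * t ^+ (d + d.-1), (len t + len t).-1).
rewrite /fraction /= prednK ?addn_gt0 ?t0 //.
have Std : S_ r u (t ^+ (d + d.-1)) by rewrite -(prednK d2); apply: S_exp.
split; first exact: S_mull.
have <- : t * t ^+ (d + d.-1) = c ^+ (len t + len t).
  by rewrite -expgS -addnS prednK // !expgnDr expd_len.
by rewrite !iM // mulgA mulgVK.
Qed.

Lemma fractionM g h m n k l :
  fraction g m k -> fraction h n l -> fraction (g * h) (m * n) (k + l.+1).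
Proof.
move=> [Sm gE] [Sn hE]; split; first exact: S_mull.
rewrite -addSn expgnDr !iM //; try exact: S_cX.
rewrite -gE -hE -!mulgA; congr (_ * _).
by rewrite mulgA (quot_cX_commute k h) -mulgA.
Qed.

(** Cross-multiplication works because the denominators are central in [G] and [i] is injective on
    S_u. *)
Lemma fraction_eq g h m n k l : fraction g m k -> fraction h n l ->
  g = h <-> m * c ^+ l.+1 = n * c ^+ k.+1.
Proof.
move=> [Sm gE] [Sn hE].
have gk : g * i (c ^+ k.+1) * i (c ^+ l.+1) = i (m * c ^+ l.+1).
  by rewrite iM ?gE //; apply: S_cX.
have hl : h * i (c ^+ k.+1) * i (c ^+ l.+1) = i (n * c ^+ k.+1).
  rewrite iM -?hE //; last exact: S_cX.
  by rewrite -!mulgA; congr (_ * _); apply: quot_cX_commute.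
split=> [gh|mn].
  apply: i_inj; last by rewrite -gk -hl gh.
  - exact: S_mull (S_cX _).
  - exact: S_mull (S_cX _).
by apply/(mulIg (i (c ^+ k.+1)))/(mulIg (i (c ^+ l.+1))); rewrite gk hl mn.
Qed.

Definition fract (g : G) : M * nat := sval (cid (fraction_exists g)).

Lemma fractP g : fraction g (fract g).1 (fract g).2.
Proof. exact: (svalP (cid (fraction_exists g))). Qed.

Definition quot_degree (g : G) : Zgroup :=
  (Posz (len (fract g).1) - Posz ((fract g).2.+1 * d))%R.

(** Taking lengths in the cross-multiplied equation shows that the degree does not depend on the
    chosen fraction. *)
Lemma quot_degreeE g m k :
  fraction g m k -> quot_degree g = (Posz (len m) - Posz (k.+1 * d))%R.
Proof.
move=> gmk; have /(fraction_eq (fractP g) gmk)/(congr1 (@len _ _)) : g = g by [].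
rewrite [LHS]lenM [RHS]lenM !len_cX // => E; apply/eqP.
by rewrite /quot_degree GRing.subr_eq GRing.addrAC eq_sym GRing.subr_eq -!PoszD E.
Qed.

Lemma quot_degreeM : {morph quot_degree : g h / g * h}.
Proof.
move=> g h; rewrite (quot_degreeE (fractionM (fractP g) (fractP h))).
rewrite /quot_degree -[RHS]/((_ : int) + (_ : int))%R.
by rewrite [len _]lenM -addSn mulnDl !PoszD GRing.opprD GRing.addrACA.
Qed.

HB.instance Definition _ :=
  isMultiplicative.Build G Zgroup quot_degree quot_degreeM.

Lemma quot_degree_gen x : S_ r u (genM r x) ->
  quot_degree (i (genM r x)) = (1%R : int).
Proof.
move=> Sx; rewrite (@quot_degreeE _ (genM r x * c) 0); last first.
  split; first exact: S_mull (S_c u_diag).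
  by rewrite expg1 iM //; apply: S_c.
by rewrite [len _]lenM [len (genM r x)]len_gen len_c // mul1n PoszD GRing.addrK.
Qed.

(** The degree and the permutation of the numerator together determine an element of [G], because
    powers of [c] have trivial permutation; in degree 0 only finitely many permutations remain. *)
Lemma finite_quot_degree_ker : finite_set [set` mker quot_degree].
Proof.
pose p g := lam_perm (fract g).1.
rewrite (_ : [set` _] = (fun g => (quot_degree g, p g)) @^-1`
   [set (0%R : int, s) | s in [set: {perm X}]]); last first.
  apply/seteqP; split=> [g /mkerP|g [s _] [gE _]]; last exact/mkerP.
  by move=> gE; exists (p g) => //; congr (_, _).
apply: finite_preimage; last by apply: finite_image; exact: finite_finset.
move=> g h _ _ [/eqP]; rewrite /quot_degree.
rewrite GRing.subr_eq GRing.addrAC eq_sym GRing.subr_eq -!PoszD => /eqP[degE] pE.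
apply/(fraction_eq (fractP g) (fractP h)); apply: (@S_perm_inj u).
- exact: S_mull (S_cX _).
- exact: S_mull (S_cX _).
- by rewrite [LHS]lenM [RHS]lenM !len_cX.
- by rewrite !lam_permM !lam_permX lam_perm_c // !expg1n !mulg1.
Qed.

End Degree.

End Quotients.

End Solution.

Theorem lemma3p4 (X : finType) (r : X * X -> X * X) (d : nat)
    (X_gt0 : (0 < #|X|)%N)
    (ybe : yang_baxter r) (lnd : left_nondegenerate r)
    (idem : idempotent_fun r)
    (d_gt0 : (0 < d)%N) (d_exp : (exponent (perm_group r) %| d)%N) :
  (forall u : X, u \in Lambda r ->
    [/\ [/\ forall a, lambda (c_ r d u) a = a,
            S_ r u (c_ r d u)
          & forall s, S_ r u s -> c_ r d u * s = s * c_ r d u],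
        S_ r u = [set c_ r d u ^+ k * f | k in [set: nat] & f in F_ r d u]
        /\ finite_set (F_ r d u),
        exists (G : groupType) (i : structure_monoid r -> G),
          group_of_quotients (S_ r u) i
      & forall (G : groupType) (i : structure_monoid r -> G),
          group_of_quotients (S_ r u) i ->
          FC_group G /\
          exists T : normal_subgroup G,
            [/\ [set` T] = torsion G,
                finite_set [set` T],
                isomorphic (quotient_group T) Zgroup
              & exists x : X, let g := i (genM r x) in
                [/\ S_ r u (genM r x),
                    forall y : quotient_group T, y \in gr (coset_class T g),
                    isomorphic G
                      (semidirect (conj_action T
                         (val : subgroup_type (gr g) -> G)))
                  & isomorphic G (semidirect (conj_action T (zpow g)))]]]) /\
  (cancellative (structure_semigroup r) <-> #|Lambda r| = 1%N).
Proof.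
split=> [u Lu|]; last exact: (cancellative_Lambda ybe lnd idem d_gt0 d_exp).
split.
- split; first exact: lambda_c; first exact: S_c.
  by move=> s; apply: c_central.
- split; [exact: S_decomposition | exact: finite_F].
- exact: (group_of_quotients_exists ybe lnd idem d_gt0 d_exp).
(* Any generator [x] in S_u has degree 1, so it can serve as x_u. *)
move=> G i quot; have [x Sx] := S_gen ybe lnd idem Lu.
pose deg := quot_degree ybe lnd idem d_gt0 d_exp Lu quot.
have fin_ker : finite_set [set` mker deg] by apply: finite_quot_degree_ker.
have deg_x : deg (i (genM r x)) = (1%R : int) by apply: quot_degree_gen.
split; first exact: (finite_by_Z_FC fin_ker).
have [T_tors T_fin TZ T_gen [split_gr split_Z]] :=
  finite_by_Z_split fin_ker deg_x.
by exists (mker_normal deg); split=> //; exists x.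
Qed.
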